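(* Let $R$ be a non-commutative ring of finite order $n$ with $Z(R)=\{0\}$. (i) Suppose $n$ is even. Then $\gamma_s(\Gamma(R))=n-1$ if and only if $R$ is isomorphic to one of the following two rings: $E=\langle x,y : 2x=2y=0,\ x^2=x,\ y^2=y,\ xy=x,\ yx=y\rangle$, $F=\langle x,y : 2x=2y=0,\ x^2=x,\ y^2=y,\ xy=y,\ yx=x\rangle$. (ii) Suppose $n$ is odd. Then $\gamma_s(\Gamma(R))=n-1$ if and only if $\Gamma(R)$ is the disjoint union of $\frac{n-1}{2}$ copies of $P_2$.
   Context: Rings are associative and are not required to have a multiplicative identity. $Z(R)$ is the center of $R$. For a non-commutative ring $R$, the commuting graph $\Gamma(R)$ is the simple graph with vertex set $R\setminus Z(R)$ in which two vertices $x,y$ are adjacent if and only if $x\neq y$ and $xy=yx$. $P_2$ is the path on two vertices (a single edge). For a vertex $v$ of a graph $G$, $N[v]$ is the closed neighbourhood of $v$ ($v$ together with its neighbours). A function $f:V(G)\to\{-1,1\}$ is a signed dominating function if $f[v]:=\sum_{u\in N[v]}f(u)\geq 1$ for every $v\in V(G)$; its weight is $\sum_{x\in V(G)}f(x)$, and the signed domination number $\gamma_s(G)$ is the minimum weight of a signed dominating function of $G$. The rings $E$ and $F$ are rings of order $4$ without identity, given by generators and relations: the additive group is $\mathbb{Z}_2x\oplus\mathbb{Z}_2y$ and the multiplication is determined by the listed products. *)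

(* Defs.v *)
From HB Require Import structures.
From mathcomp Require Import all_boot all_order all_algebra.
From mathcomp Require Import ring.

Set Implicit Arguments.
Unset Strict Implicit.
Unset Printing Implicit Defensive.

Import Order.TTheory GRing.Theory Num.Theory.
Local Open Scope ring_scope.

(* Associative rings with no identity element required: every ring structure
   of ssralg carries a 1, so the multiplication is added on top of zmodType. *)
HB.mixin Record Zmodule_isNuRing R of GRing.Zmodule R := {
  numul : R -> R -> R;
  numulA : associative numul;
  numulDl : left_distributive numul +%R;
  numulDr : right_distributive numul +%R
}.

#[short(type="nuRingType")]
HB.structure Definition NuRing := {R of GRing.Zmodule R & Zmodule_isNuRing R}.

#[short(type="finNuRingType")]
HB.structure Definition FinNuRing := {R of NuRing R & Finite R}.

Notation "x ** y" := (numul x y) (at level 40, left associativity) : ring_scope.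

Definition nucenter (R : finNuRingType) : {set R} :=
  [set z | [forall x, z ** x == x ** z]].

Definition nuring_isom (R S : nuRingType) : Prop :=
  exists f : R -> S,
    [/\ bijective f, {morph f : x y / x + y} & {morph f : x y / x ** y}].

(* A row vector (a, b) stands for a x + b y in Z_2 x (+) Z_2 y, and [bilin2] is
   the bilinear product prescribed by the four values x^2, xy, yx and y^2. *)
Definition gx : 'rV['F_2]_2 := delta_mx 0 0.
Definition gy : 'rV['F_2]_2 := delta_mx 0 1.

Definition bilin2 (xx xy yx yy p q : 'rV['F_2]_2) : 'rV['F_2]_2 :=
  (p 0 0 * q 0 0) *: xx + (p 0 0 * q 0 1) *: xy +
  (p 0 1 * q 0 0) *: yx + (p 0 1 * q 0 1) *: yy.

Definition ringE : Type := 'rV['F_2]_2.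
Definition ringF : Type := 'rV['F_2]_2.

HB.instance Definition _ := Finite.on ringE.
HB.instance Definition _ := GRing.Zmodule.on ringE.
HB.instance Definition _ := Finite.on ringF.
HB.instance Definition _ := GRing.Zmodule.on ringF.

(* x^2 = x, xy = x, yx = y, y^2 = y *)
Definition mulE : ringE -> ringE -> ringE := bilin2 gx gx gy gy.

(* x^2 = x, xy = y, yx = x, y^2 = y *)
Definition mulF : ringF -> ringF -> ringF := bilin2 gx gy gx gy.

Lemma bilin2Dl xx xy yx yy : left_distributive (bilin2 xx xy yx yy) +%R.
Proof. by move=> p q r; apply/rowP=> i; rewrite !mxE; ring. Qed.

Lemma bilin2Dr xx xy yx yy : right_distributive (bilin2 xx xy yx yy) +%R.
Proof. by move=> p q r; apply/rowP=> i; rewrite !mxE; ring. Qed.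

Lemma mulEA : associative mulE.
Proof.
move=> p q r; apply/rowP=> i; rewrite /mulE /bilin2 !mxE /=.
by case: (i == 0); case: (i == 1) => /=; ring.
Qed.

Lemma mulFA : associative mulF.
Proof.
move=> p q r; apply/rowP=> i; rewrite /mulF /bilin2 !mxE /=.
by case: (i == 0); case: (i == 1) => /=; ring.
Qed.

HB.instance Definition _ :=
  Zmodule_isNuRing.Build ringE mulEA (bilin2Dl _ _ _ _) (bilin2Dr _ _ _ _).
HB.instance Definition _ :=
  Zmodule_isNuRing.Build ringF mulFA (bilin2Dl _ _ _ _) (bilin2Dr _ _ _ _).

Record sgraph := SGraph {
  vertex :> finType;
  adj : rel vertex;
  adj_sym : symmetric adj;
  adj_irr : irreflexive adj
}.

Definition sgraph_isom (G H : sgraph) : Prop :=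
  exists2 f : G -> H, bijective f & forall u v, adj (f u) (f v) = adj u v.

Section PathGraph.
Variable k : nat.

Definition path_adj (i j : 'I_k) : bool :=
  (i.+1 == j :> nat) || (j.+1 == i :> nat).

Lemma path_adj_sym : symmetric path_adj.
Proof. by move=> i j; rewrite /path_adj orbC. Qed.

Lemma path_adj_irr : irreflexive path_adj.
Proof. by move=> i; rewrite /path_adj orbb gtn_eqF. Qed.

(* the path on k vertices (k - 1 edges) *)
Definition path_graph : sgraph := SGraph path_adj_sym path_adj_irr.

End PathGraph.

Section Copies.
Variables (k : nat) (G : sgraph).

Definition copies_adj (u v : 'I_k * G) : bool :=
  (u.1 == v.1) && adj u.2 v.2.

Lemma copies_adj_sym : symmetric copies_adj.
Proof. by move=> u v; rewrite /copies_adj eq_sym adj_sym. Qed.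

Lemma copies_adj_irr : irreflexive copies_adj.
Proof. by move=> u; rewrite /copies_adj adj_irr andbF. Qed.

(* the disjoint union of k copies of G *)
Definition copies : sgraph := SGraph copies_adj_sym copies_adj_irr.

End Copies.

Section CommutingGraph.
Variable R : finNuRingType.

Definition noncentral : finType := {x : R | x \notin nucenter R}.

Definition comm_adj (u v : noncentral) : bool :=
  (u != v) && (val u ** val v == val v ** val u).

Lemma comm_adj_sym : symmetric comm_adj.
Proof. by move=> u v; rewrite /comm_adj eq_sym [_ ** _ == _]eq_sym. Qed.

Lemma comm_adj_irr : irreflexive comm_adj.
Proof. by move=> u; rewrite /comm_adj eqxx. Qed.

Definition commuting_graph : sgraph := SGraph comm_adj_sym comm_adj_irr.

End CommutingGraph.

(* the two-element type {-1, 1}, with [val] its inclusion into int *)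
Definition pm1 : finType := seq_sub [:: -1; 1 : int].
Definition pm1_one : pm1 := @SeqSub _ [:: -1; 1 : int] 1 isT.

Section SignedDomination.
Variable G : sgraph.

Definition closed_nbhd (v : G) : {set G} := v |: [set u | adj v u].

Definition signed_dominating (f : {ffun G -> pm1}) : bool :=
  [forall v, 1 <= \sum_(u in closed_nbhd v) val (f u)].

Definition sdf_weight (f : {ffun G -> pm1}) : int := \sum_x val (f x).

Lemma signed_dominating_one : signed_dominating [ffun=> pm1_one].
Proof.
apply/forallP=> v; rewrite (bigD1 v) ?setU11 //= ffunE lerDl.
by apply: sumr_ge0 => u _; rewrite ffunE.
Qed.

(* The starting point of the arg min is a signed dominating function by
   [signed_dominating_one], so this is a genuine minimum: see [gamma_sP]. *)
Definition gamma_s : int :=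
  sdf_weight
    [arg min_(f < [ffun=> pm1_one] | signed_dominating f) sdf_weight f]%O.

Lemma gamma_sP :
  (exists2 f, signed_dominating f & sdf_weight f = gamma_s) /\
  (forall f, signed_dominating f -> gamma_s <= sdf_weight f).
Proof.
rewrite /gamma_s; case: arg_minP => [|f sdf_f min_f].
  exact: signed_dominating_one.
by split; [exists f | exact: min_f].
Qed.

End SignedDomination.

(* Main.v *)
Require Import Defs.
From mathcomp Require Import all_boot all_order all_algebra.
From mathcomp Require Import all_fingroup all_solvable zify.

Set Implicit Arguments.
Unset Strict Implicit.
Unset Printing Implicit Defensive.

Import Order.TTheory GRing.Theory Num.Theory.
Local Open Scope ring_scope.

(** The commuting graph has n - 1 vertices, so the hypothesis on its signed
    domination number says that the all-one function is optimal. In any graph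
    this happens exactly when no single vertex can be flipped to -1, that is,
    when every closed neighbourhood contains a vertex whose own closed
    neighbourhood has at most two elements ([gamma_s_eq_card]).

    In the commuting graph, the closed neighbourhood of v together with 0 is
    the centralizer of v. A centralizer with at most three elements can only be
    {0, v, -v}: another element y would contribute y and v + y. If w commutes
    with such a v, then w = v or w = -v, so w has the same centralizer. The
    hypothesis thus becomes: every x <> 0 commutes only with 0, x and -x
    ([tight_centralizers], [gamma_s_commuting_graph]).

    For n odd, x and -x differ, so the graph is the perfect matching x ~ -x.

    For n even, there is an element of order 2. It would commute with any
    element of order 3, which forces characteristic 2: a nonzero x commutes
    only with 0 and x. The ring is not Boolean, as it would be commutative, and
    x ** x is 0 or x, so some w <> 0 has square 0. In characteristic 2 the
    additive map u |-> wu + uw then has square 0, so both its image and its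
    kernel lie in {0, w}, and the ring has four elements 0, w, a, a + w
    ([tight_char2_structure]). Comparing aw and wa leaves two multiplication
    tables, those of E and F. Conversely, in E and F two elements commute only
    if their coordinate vectors are parallel over the field with two
    elements. *)

(** * Graphs whose signed domination number is the order *)

Lemma val_pm1 (s : pm1) : val s = -1 \/ val s = 1.
Proof. by have := valP s; rewrite !inE => /orP[] /eqP; [left|right]. Qed.

Lemma closed_nbhd_refl (G : sgraph) (v : G) : v \in closed_nbhd v.
Proof. exact: setU11. Qed.

Lemma closed_nbhd_sym (G : sgraph) (u v : G) :
  (u \in closed_nbhd v) = (v \in closed_nbhd u).
Proof. by rewrite !inE eq_sym adj_sym. Qed.

Definition flip_at (G : sgraph) (w : G) : {ffun G -> pm1} :=
  [ffun u => if u == w then @SeqSub _ [:: -1; 1 : int] (-1) isT else pm1_one].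

Lemma sum_flip_at (G : sgraph) (w : G) (A : {set G}) :
  \sum_(u in A) val (flip_at w u) = #|A|%:Z - (w \in A)%:Z *+ 2.
Proof.
have -> : \sum_(u in A) val (flip_at w u)
        = \sum_(u in A) (1 - (u == w)%:Z *+ 2).
  by apply: eq_bigr => u _; rewrite ffunE; case: eqP.
rewrite sumrB sumr_const natz; congr (_ - _).
have [wA|wA] := boolP (w \in A); last first.
  rewrite big1 // => u uA; have [uw|//] := eqVneq u w; by rewrite -uw uA in wA.
by rewrite (bigD1 w) //= eqxx big1 ?addr0 // => u /andP[_ /negPf->].
Qed.

(** If every vertex near w has at least three vertices in its closed
    neighbourhood, flipping w costs each of these sums 2 and leaves it at least
    1. If instead v near w has at most two, then the value -1 at w cannot be
    compensated in the sum over the closed neighbourhood of v. *)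
Lemma gamma_s_eq_card (G : sgraph) :
  gamma_s G = #|G|%:Z <->
  forall w : G, exists2 v, v \in closed_nbhd w & (#|closed_nbhd v| <= 2)%N.
Proof.
have [[f0 sdf_f0 wt_f0] min_gamma] := gamma_sP G; split=> [gammaE w|leafy].
  apply/exists_inP/contraT => /exists_inPn big_nbhd.
  suff /min_gamma : signed_dominating (flip_at w).
    have -> : sdf_weight (flip_at w) = #|[set: G]|%:Z - 1 *+ 2.
      rewrite -[1 in RHS]/((true : nat)%:Z) -(in_setT w) -sum_flip_at.
      by apply: eq_bigl => u; rewrite in_setT.
    by rewrite gammaE cardsT; lia.
  apply/forallP=> v; rewrite sum_flip_at.
  case: (boolP (w \in _)) => [|_].
    by rewrite closed_nbhd_sym => /big_nbhd; lia.
  have : (0 < #|closed_nbhd v|)%N.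
    by apply/card_gt0P; exists v; exact: closed_nbhd_refl.
  by lia.
rewrite -{}wt_f0 /sdf_weight (eq_bigr (fun=> 1)) => [|w _].
  by rewrite sumr_const -natz.
have [f0wN1|//] := val_pm1 (f0 w).
have [v] := leafy w; rewrite closed_nbhd_sym => vw small_v.
have /forallP/(_ v) := sdf_f0; rewrite (bigD1 w) // f0wN1.
suff le1 : \sum_(u in closed_nbhd v | u != w) val (f0 u) <= 1.
  by move=> /le_trans/(_ (lerD (lexx _) le1)).
apply: (@le_trans _ _ (\sum_(u in closed_nbhd v :\ w) 1)).
  rewrite (eq_bigl (mem (closed_nbhd v :\ w))) => [|u].
    by apply: ler_sum => u _; have [->|->] := val_pm1 (f0 u).
  by rewrite !inE andbC.
by rewrite sumr_const; have := cardsD1 w (closed_nbhd v); rewrite vw natz; lia.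
Qed.

(** * Perfect matchings *)

(** Taking from each pair {x, s x} the element of smaller rank gives a
    transversal. *)
Lemma half_transversal (T : finType) (s : T -> T) :
  involutive s -> (forall x, s x != x) ->
  exists A : {set T}, s @: A = ~: A /\ #|T| = (2 * #|A|)%N.
Proof.
move=> sK s_free.
pose A := [set x | (enum_rank x < enum_rank (s x))%N].
have sA : s @: A = ~: A.
  apply/setP=> x; rewrite -[x in LHS]sK mem_imset; last exact: inv_inj.
  rewrite !inE sK -leqNgt ltn_neqAle (inj_eq (@ord_inj _)).
  by rewrite (inj_eq enum_rank_inj) s_free.
exists A; split=> //; rewrite -(cardsC A) -sA card_imset; last exact: inv_inj.
by rewrite mul2n addnn.
Qed.

(** The copies of the edge are indexed by a transversal of the orbits of s: the
    first end of each is the chosen element and the second its image by s. *)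
Lemma involution_matching (G : sgraph) (s : G -> G) :
  involutive s -> (forall x, s x != x) -> (forall u v, adj u v = (v == s u)) ->
  sgraph_isom G (copies (#|G| %/ 2)%N (path_graph 2)).
Proof.
move=> sK s_free adjE.
have [A [sA cardG]] := half_transversal sK s_free.
rewrite cardG mulKn //.
have sAP (a b : 'I_#|A|) : s (enum_val a) != enum_val b.
  apply: contraTneq (enum_valP b) => <-.
  by rewrite -in_setC -sA imset_f ?enum_valP.
have ord2 (i : 'I_2) : i = ord0 \/ i = ord_max.
  by case: i => [[|[|//]] ?]; [left|right]; apply: val_inj.
pose g (p : copies #|A| (path_graph 2)) : G :=
  if p.2 == ord0 :> 'I_2 then enum_val p.1 else s (enum_val p.1).
have injg : injective g.
  move=> [a i] [b j]; rewrite /g /=.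
  case: (ord2 i) (ord2 j) => -> [->|->] /= /eqP.
  - by move=> /eqP/enum_val_inj->.
  - by rewrite eq_sym (negPf (sAP _ _)).
  - by rewrite (negPf (sAP _ _)).
  - by move=> /eqP/(inv_inj sK)/enum_val_inj->.
have cardg : (#|G| <= #|copies #|A| (path_graph 2)|)%N.
  by rewrite card_prod !card_ord cardG mulnC.
have [f gK fK] := inj_card_bij injg cardg.
exists f => [|u v]; first by exists g.
rewrite -{2}(fK u) -{2}(fK v); case: (f u) (f v) => [a i] [b j].
rewrite adjE /g /= /copies_adj /= /path_adj.
case: (ord2 i) (ord2 j) => -> [->|->] /=.
- by rewrite andbF eq_sym (negPf (sAP _ _)).
- by rewrite andbT (inj_eq (inv_inj sK)) (inj_eq enum_val_inj) eq_sym.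
- by rewrite andbT sK (inj_eq enum_val_inj) eq_sym.
- by rewrite andbF sK (negPf (sAP _ _)).
Qed.

Lemma card_closed_nbhd_copies_P2 k (v : copies k (path_graph 2)) :
  (#|closed_nbhd v| <= 2)%N.
Proof.
apply: (@leq_trans #|setX [set v.1] [set: 'I_2]|); last first.
  by rewrite cardsX cards1 cardsT card_ord.
apply/subset_leq_card/subsetP=> u; rewrite !inE andbT => /predU1P[->//|].
by case/andP; rewrite eq_sym.
Qed.

Lemma card_closed_nbhd_isom (G H : sgraph) (f : G -> H) (v : G) :
  bijective f -> (forall u w, adj (f u) (f w) = adj u w) ->
  #|closed_nbhd (f v)| = #|closed_nbhd v|.
Proof.
move=> bij_f adj_f; rewrite -(card_imset _ (bij_inj bij_f)); apply/eq_card=> w.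
have [g fK gK] := bij_f; rewrite -(gK w) mem_imset; last exact: bij_inj.
by rewrite !inE adj_f (inj_eq (bij_inj bij_f)).
Qed.

Lemma gamma_s_matching (G : sgraph) k :
  sgraph_isom G (copies k (path_graph 2)) -> gamma_s G = #|G|%:Z.
Proof.
case=> f bij_f adj_f; apply/gamma_s_eq_card=> v; exists v.
  exact: closed_nbhd_refl.
by rewrite -(card_closed_nbhd_isom v bij_f adj_f) card_closed_nbhd_copies_P2.
Qed.

(** * Tight centralizers *)

Lemma numul0r (R : nuRingType) (x : R) : 0 ** x = 0.
Proof. by apply: (addIr (0 ** x)); rewrite -numulDl !add0r. Qed.

Lemma numulr0 (R : nuRingType) (x : R) : x ** 0 = 0.
Proof. by apply: (addIr (x ** 0)); rewrite -numulDr !add0r. Qed.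

Lemma numulNr (R : nuRingType) (x y : R) : (- x) ** y = - (x ** y).
Proof. by apply: (addIr (x ** y)); rewrite -numulDl !addNr numul0r. Qed.

Lemma numulrN (R : nuRingType) (x y : R) : x ** (- y) = - (x ** y).
Proof. by apply: (addIr (x ** y)); rewrite -numulDr !addNr numulr0. Qed.

Definition centralizer (R : finNuRingType) (x : R) : {set R} :=
  [set y | x ** y == y ** x].

(** The ring-theoretic form of the extremal condition: 0, x and -x always
    commute with x, so these centralizers are as small as possible. *)
Definition tight_centralizers (R : nuRingType) : Prop :=
  forall x y : R, x != 0 -> x ** y = y ** x -> [\/ y = 0, y = x | y = - x].

Lemma mem_noncentral (R : finNuRingType) (x : R) :
  nucenter R = [set 0] -> (x \notin nucenter R) = (x != 0).
Proof. by move=> ->; rewrite inE. Qed.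

Lemma card_commuting_graph (R : finNuRingType) :
  nucenter R = [set 0] -> #|commuting_graph R|%:Z = #|R|%:Z - 1.
Proof.
move=> center_R; rewrite -(cardsC (nucenter R)) {1}center_R cards1.
rewrite PoszD addrAC subrr add0r card_sig; congr Posz.
by apply: eq_card => x; rewrite !inE.
Qed.

Lemma card_closed_nbhd_commuting (R : finNuRingType) (v : commuting_graph R) :
  nucenter R = [set 0] -> #|centralizer (val v)| = #|closed_nbhd v|.+1.
Proof.
move=> center_R; rewrite (cardsD1 0) inE numul0r numulr0 eqxx.
rewrite -(card_imset _ val_inj); congr (_.+1); apply/eq_card=> y.
rewrite !inE; apply/andP/imsetP=> [[y0 vy]|[u]].
  rewrite -(mem_noncentral _ center_R) in y0.
  exists (Sub y y0); rewrite ?SubK // !inE /= /comm_adj SubK vy andbT eq_sym.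
  exact: orbN.
rewrite !inE => /predU1P[->|/andP[_ vu]]; rewrite -(mem_noncentral _ center_R).
  by move=> ->; split; first exact: (valP v).
by move=> ->; split; first exact: (valP u).
Qed.

(** Besides 0 and x, a fourth kind of element y would give the four distinct
    elements 0, x, y, x + y of the centralizer. *)
Lemma small_centralizer (R : finNuRingType) (x y : R) :
  x != 0 -> (#|centralizer x| <= 3)%N -> x ** y = y ** x ->
  [\/ y = 0, y = x | y = - x].
Proof.
move=> x0 small xy.
have [->|y0] := eqVneq y 0; first by constructor 1.
have [->|yx] := eqVneq y x; first by constructor 2.
have [->|yNx] := eqVneq y (- x); first by constructor 3.
pose s := [:: 0; x; y; x + y].
suff : (#|s| <= #|centralizer x|)%N.
  rewrite (card_uniqP _) => [/leq_trans/(_ small)//|] /=.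
  rewrite !inE !negb_or ![0 == _]eq_sym x0 y0 addrC addr_eq0 yNx.
  rewrite [x == y]eq_sym yx -subr_eq0 opprD addrCA subrr addr0 oppr_eq0 y0.
  by rewrite -subr_eq0 opprD addrA subrr sub0r oppr_eq0 x0.
apply/subset_leq_card/subsetP=> z; rewrite !inE => /or4P[] /eqP->.
- by rewrite numul0r numulr0.
- by [].
- by rewrite xy.
- by rewrite numulDl numulDr xy.
Qed.

(** A vertex v close to x with a small centralizer is x or -x, so that x itself
    has a small centralizer. *)
Lemma gamma_s_commuting_graph (R : finNuRingType) :
  nucenter R = [set 0] ->
  gamma_s (commuting_graph R) = #|R|%:Z - 1 <-> tight_centralizers R.
Proof.
move=> center_R; rewrite -card_commuting_graph //.
apply: (iff_trans (gamma_s_eq_card _)); split=> [leafy x y x0 xy|tightR v].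
  have x_nc : x \notin nucenter R by rewrite mem_noncentral.
  have [v xv] := leafy (Sub x x_nc : commuting_graph R).
  rewrite -ltnS -card_closed_nbhd_commuting // => small_v.
  have v0 : val v != 0 by rewrite -mem_noncentral //; exact: (valP v).
  have vx : val v ** x = x ** val v.
    move: xv; rewrite !inE => /predU1P[->//|/andP[_ /eqP]].
    by rewrite SubK.
  have [x_eq|x_eq|x_eq] := small_centralizer v0 small_v vx.
  - by rewrite x_eq eqxx in x0.
  - by move: xy; rewrite x_eq; exact: small_centralizer.
  - move: xy; rewrite x_eq numulNr numulrN opprK => /oppr_inj.
    by case/(small_centralizer v0 small_v);
      [constructor 1|constructor 3|constructor 2].
exists v; first exact: closed_nbhd_refl.
have v0 : val v != 0 by rewrite -mem_noncentral //; exact: (valP v).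
rewrite -ltnS -card_closed_nbhd_commuting //.
apply: leq_trans (card_size [:: 0; val v; - val v]).
apply/subset_leq_card/subsetP=> y; rewrite !inE => /eqP/(tightR _ _ v0).
by case=> ->; rewrite eqxx ?orbT.
Qed.

(** * Even order *)

Lemma odd_card_zmod (M : finZmodType) :
  odd #|M| <-> forall x : M, x + x = 0 -> x = 0.
Proof.
rewrite -cardsT; split=> [oddM x x2|inj2].
  have ox2 : (#[x]%g %| 2)%N by rewrite order_dvdn FinRing.zmodXgE mulr2n x2.
  have /dvdn_odd/(_ oddM) := order_dvdG (in_setT x).
  rewrite -[0]/(1%g : M); apply: contraTeq; rewrite -order_eq1.
  by move: ox2; rewrite dvdn_divisors // !inE => /orP[] // /eqP->.
apply: contraT; rewrite -dvdn2 => /(Cauchy (isT : prime 2))[x _ ox].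
suff x0 : x = 1%g by rewrite x0 order1 in ox.
by apply: inj2; rewrite -mulr2n -FinRing.zmodXgE -ox expg_order.
Qed.

(** Otherwise x + x commutes with x and must be -x. An element u of order 2 then
    satisfies -xu = (x + x)u = x(u + u) = 0 and likewise ux = 0, so u is x or
    -x, whose doubles do not vanish. Without elements of order 2 the order of
    the ring is odd. *)
Lemma tight_even_char2 (R : finNuRingType) :
  tight_centralizers R -> ~~ odd #|R| -> forall x : R, x + x = 0.
Proof.
move=> tightR evenR x; have [//|x2] := eqVneq (x + x) 0.
suff : odd #|R| by rewrite (negPf evenR).
apply/odd_card_zmod=> u u2.
have x0 : x != 0 by apply: contraNneq x2 => ->; rewrite addr0.
have x2N : x + x = - x.
  have comm2 : x ** (x + x) = (x + x) ** x by rewrite numulDl numulDr.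
  have [E|E|//] := tightR x (x + x) x0 comm2.
    by rewrite E eqxx in x2.
  by move/eqP: E; rewrite -subr_eq0 addrK (negPf x0).
have xu : x ** u = 0.
  by apply: oppr_inj; rewrite -numulNr -x2N numulDl -numulDr u2 numulr0 oppr0.
have ux : u ** x = 0.
  by apply: oppr_inj; rewrite -numulrN -x2N numulDr -numulDl u2 numul0r oppr0.
have [//|ux_eq|ux_eq] := tightR x u x0 (etrans xu (esym ux)).
  by rewrite -ux_eq u2 eqxx in x2.
by move/eqP: u2; rewrite ux_eq -opprD oppr_eq0 (negPf x2).
Qed.

Lemma oppr_char2 (M : zmodType) :
  (forall x : M, x + x = 0) -> forall x : M, - x = x.
Proof. by move=> char2 x; apply/eqP; rewrite -subr_eq0 -opprD char2 oppr0. Qed.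

(** If only 0 had square 0, every z would be idempotent, because z ** z
    commutes with z; and a Boolean ring is commutative. *)
Lemma tight_square_zero (R : finNuRingType) :
  (forall x : R, x + x = 0) -> tight_centralizers R ->
  ~ commutative (@numul R) -> exists2 w : R, w != 0 & w ** w = 0.
Proof.
move=> char2 tightR noncomm; apply/exists_eq_inP/contraT => /exists_inPn red.
case: noncomm => x y.
have idem (z : R) : z ** z = z.
  have [->|z0] := eqVneq z 0; first exact: numul0r.
  have [zz0|//|->] := tightR z (z ** z) z0 (numulA z z z).
    by have := red z z0; rewrite zz0 eqxx.
  exact: oppr_char2.
have := idem (x + y); rewrite numulDl !numulDr !idem [y ** x + y]addrC addrACA.
rewrite -[RHS]addr0 => /addrI/eqP; rewrite addr_eq0 => /eqP->.
exact: oppr_char2.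
Qed.

Lemma tight_centralizer2 (R : nuRingType) (w x : R) :
  (forall x : R, x + x = 0) -> tight_centralizers R -> w != 0 ->
  w ** x = x ** w -> x = 0 \/ x = w.
Proof.
move=> char2 tightR w0 /(tightR _ _ w0)[->|->|->]; [by left|by right|right].
exact: oppr_char2.
Qed.

(** In characteristic 2 the commutator with a square-zero element w is an
    additive map of square 2 w u w = 0, so its values commute with w. *)
Lemma square_zero_commutator (R : nuRingType) (w u : R) :
  (forall x : R, x + x = 0) -> tight_centralizers R ->
  w != 0 -> w ** w = 0 -> w ** u + u ** w = 0 \/ w ** u + u ** w = w.
Proof.
move=> char2 tightR w0 ww; apply: tight_centralizer2 => //.
by rewrite numulDr numulDl !numulA ww numul0r add0r -[u ** w ** w]numulA ww
           numulr0 addr0.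
Qed.

(** w ** u ** w is the product of w by its commutator with u, which is 0 or
    w. *)
Lemma square_zero_sandwich (R : nuRingType) (w u : R) :
  (forall x : R, x + x = 0) -> tight_centralizers R ->
  w != 0 -> w ** w = 0 -> w ** u ** w = 0.
Proof.
move=> char2 tightR w0 ww.
have -> : w ** u ** w = w ** (w ** u + u ** w).
  by rewrite numulDr !numulA ww numul0r add0r.
by have [->|->] := square_zero_commutator u char2 tightR w0 ww;
  rewrite ?numulr0.
Qed.

Lemma square_zero_mulr (R : nuRingType) (w u : R) :
  (forall x : R, x + x = 0) -> tight_centralizers R ->
  w != 0 -> w ** w = 0 -> u ** w = 0 \/ u ** w = w.
Proof.
move=> char2 tightR w0 ww; apply: tight_centralizer2 => //.
by rewrite numulA square_zero_sandwich // -numulA ww numulr0.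
Qed.

(** For a not commuting with w, every element is in {0, w} or becomes so after
    adding a, according to whether its commutator with w is 0 or w. As
    the commutator of a is w = aw + wa, exactly one of aw, wa is w. The two
    idempotents are a and a + w. *)
Lemma tight_char2_structure (R : finNuRingType) :
  (forall x : R, x + x = 0) -> tight_centralizers R ->
  nucenter R = [set 0] -> ~ commutative (@numul R) ->
  exists x y : R,
    [/\ x != 0, y != 0, x != y, forall z, z \in [:: 0; x; y; x + y] &
      [/\ x ** x = x, y ** y = y &
          (x ** y = x /\ y ** x = y) \/ (x ** y = y /\ y ** x = x)]].
Proof.
move=> char2 tightR center_R noncomm.
have [w w0 ww] := tight_square_zero char2 tightR noncomm.
have [a wa] : exists a, w ** a != a ** w.
  apply/existsP; rewrite -negb_forall; apply: contra w0.
  by move=> wC; rewrite -in_set1 -center_R inE.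
have N := oppr_char2 char2.
have commP x : w ** x = x ** w -> x = 0 \/ x = w.
  exact: tight_centralizer2.
have a0 : a != 0 by apply: contraNneq wa => ->; rewrite numul0r numulr0.
have aw : a != w by apply: contraNneq wa => ->.
have adw x : w ** x + x ** w = 0 \/ w ** x + x ** w = w.
  exact: square_zero_commutator.
have commE x : w ** x + x ** w = 0 -> w ** x = x ** w.
  by move/eqP; rewrite addr_eq0 N => /eqP.
have adwa : w ** a + a ** w = w.
  by have [/commE E|//] := adw a; rewrite E eqxx in wa.
have R4 z : [\/ z = 0, z = w, z = a | z = a + w].
  have [/commE/commP[->|->]|adwz] := adw z;
    [by constructor 1|by constructor 2|].
  have /commE/commP : w ** (z + a) + (z + a) ** w = 0.
    by rewrite numulDr numulDl addrACA adwz adwa char2.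
  case=> /eqP; first by rewrite addr_eq0 N => /eqP->; constructor 3.
  rewrite -(inj_eq (addIr a)) -addrA char2 addr0 addrC => /eqP->.
  by constructor 4.
have aa : a ** a = a.
  have [aa0|//] : a ** a = 0 \/ a ** a = a.
    by apply: tight_centralizer2 => //; exact: numulA.
  have awE : a ** w = 0.
    have [//|aww] := square_zero_mulr a char2 tightR w0 ww.
    by rewrite aww; have := numulA a a w; rewrite !aww aa0 numul0r.
  move: adwa; rewrite awE addr0 => waw.
  by case/eqP: w0; have := numulA w a a; rewrite !waw aa0 numulr0.
have aw_wa : (a ** w = 0 /\ w ** a = w) \/ (a ** w = w /\ w ** a = 0).
  move: adwa; have [->|->] := square_zero_mulr a char2 tightR w0 ww.
    by rewrite addr0; left.
  by move/eqP; rewrite -subr_eq0 addrK => /eqP; right.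
exists a, (a + w); split=> //.
- by rewrite addr_eq0 N.
- by rewrite -subr_eq0 opprD addrA subrr sub0r oppr_eq0.
- move=> z; rewrite addrA char2 add0r !inE.
  by case: (R4 z) => ->; rewrite eqxx ?orbT.
rewrite !numulDr !numulDl ww aa addr0.
case: aw_wa => [[-> ->]|[-> ->]]; rewrite ?add0r ?addr0; split=> //.
- by left.
- by right.
Qed.

(** * The rings E and F *)

Lemma F2P (a : 'F_2) : a = 0 \/ a = 1.
Proof. by case: a => [[|[|//]] ?]; [left|right]; apply: val_inj. Qed.

(** Scalar multiplication by the field with two elements. It is additive in the
    scalar only in characteristic 2, which is why it is a function rather than
    a module structure. *)
Definition F2scale (M : zmodType) (a : 'F_2) (x : M) : M :=
  if a == 0 then 0 else x.

Lemma F2scaleDl (M : zmodType) (a b : 'F_2) (x : M) :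
  x + x = 0 -> F2scale (a + b) x = F2scale a x + F2scale b x.
Proof.
by move=> x2; rewrite /F2scale;
   case: (F2P a) (F2P b) => -> [->|->] /=; rewrite ?addr0 ?add0r ?x2.
Qed.

Lemma F2scaleDr (M : zmodType) (a : 'F_2) (x y : M) :
  F2scale a (x + y) = F2scale a x + F2scale a y.
Proof. by rewrite /F2scale; case: eqP; rewrite ?addr0. Qed.

Lemma F2scaleA (M : zmodType) (a b : 'F_2) (x : M) :
  F2scale (a * b) x = F2scale a (F2scale b x).
Proof. by rewrite /F2scale mulf_eq0; case: eqP; case: eqP. Qed.

Lemma F2scaleM (R : nuRingType) (a b : 'F_2) (x y : R) :
  F2scale a x ** F2scale b y = F2scale (a * b) (x ** y).
Proof.
by rewrite /F2scale mulf_eq0; case: eqP; case: eqP; rewrite ?numul0r ?numulr0.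
Qed.

Lemma row2P (T : Type) (r s : 'rV[T]_2) :
  r 0 0 = s 0 0 -> r 0 1 = s 0 1 -> r = s.
Proof.
move=> E0 E1; apply/rowP => i.
have [->//|->//] : i = 0 \/ i = 1.
by case: i => [[|[|//]] ?]; [left|right]; apply: val_inj.
Qed.

Definition F2comb (M : zmodType) (x y : M) (p : 'rV['F_2]_2) : M :=
  F2scale (p 0 0) x + F2scale (p 0 1) y.

Lemma F2combD (M : zmodType) (x y : M) :
  (forall z : M, z + z = 0) -> {morph F2comb x y : p q / p + q}.
Proof. by move=> char2 p q; rewrite /F2comb !mxE !F2scaleDl // addrACA. Qed.

Lemma F2combZ (M : zmodType) (x y : M) (a : 'F_2) (p : 'rV['F_2]_2) :
  F2comb x y (a *: p) = F2scale a (F2comb x y p).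
Proof. by rewrite /F2comb !mxE F2scaleDr !F2scaleA. Qed.

Lemma F2comb_gx (M : zmodType) (x y : M) : F2comb x y gx = x.
Proof. by rewrite /F2comb /F2scale !mxE /= addr0. Qed.

Lemma F2comb_gy (M : zmodType) (x y : M) : F2comb x y gy = y.
Proof. by rewrite /F2comb /F2scale !mxE /= add0r. Qed.

(** Since [bilin2] extends its table bilinearly, a linear combination map is
    multiplicative as soon as it is so on the two generators. *)
Lemma F2comb_bilin2 (R : nuRingType) (x y : R) (xx xy yx yy p q : 'rV['F_2]_2) :
  (forall z : R, z + z = 0) ->
  F2comb x y xx = x ** x -> F2comb x y xy = x ** y ->
  F2comb x y yx = y ** x -> F2comb x y yy = y ** y ->
  F2comb x y (bilin2 xx xy yx yy p q) = F2comb x y p ** F2comb x y q.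
Proof.
move=> char2 Exx Exy Eyx Eyy.
rewrite /bilin2 !F2combD // !F2combZ Exx Exy Eyx Eyy /F2comb.
by rewrite numulDl !numulDr !F2scaleM addrA.
Qed.

(** Injectivity is linear independence over the field with two elements, and
    the target has at most as many elements as the four vectors. *)
Lemma F2comb_bij (M : finZmodType) (x y : M) :
  (forall z : M, z + z = 0) -> x != 0 -> y != 0 -> x != y ->
  (forall z, z \in [:: 0; x; y; x + y]) -> bijective (F2comb x y).
Proof.
move=> char2 x0 y0 xy span; have N := oppr_char2 char2.
apply: inj_card_bij => [p q /eqP|]; last first.
  rewrite card_mx card_Fp //.
  apply: leq_trans (card_size [:: 0; x; y; x + y]).
  by apply/subset_leq_card/subsetP.
rewrite -subr_eq0 -{1}(N (F2comb x y q)) opprK -F2combD // => comb0.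
apply/eqP; rewrite -subr_eq0; move: comb0.
have -> : p - q = p + q.
  congr (_ + _); apply/rowP=> i; rewrite !mxE.
  by case: (F2P (q 0 i)) => ->; apply: val_inj.
move: (p + q) => {p q} r; rewrite /F2comb /F2scale.
have [r0|r0] := F2P (r 0 0); have [r1|r1] := F2P (r 0 1); rewrite r0 r1 /=.
- by move=> _; apply/eqP/row2P; rewrite mxE.
- by rewrite add0r (negPf y0).
- by rewrite addr0 (negPf x0).
- by rewrite addr_eq0 N (negPf xy).
Qed.

Lemma nuring_isom_sym (R S : nuRingType) : nuring_isom R S -> nuring_isom S R.
Proof.
case=> f [[g fK gK] fD fM]; exists g; split; first by exists f.
- by move=> x y; apply: (can_inj fK); rewrite fD !gK.
- by move=> x y; apply: (can_inj fK); rewrite fM !gK.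
Qed.

Lemma tight_isom (R S : nuRingType) :
  nuring_isom R S -> tight_centralizers S -> tight_centralizers R.
Proof.
case=> f [bij_f fD fM] tightS x y x0 xy; have inj_f := bij_inj bij_f.
have f0 : f 0 = 0 by apply: (addIr (f 0)); rewrite -fD !add0r.
have fN z : f (- z) = - f z by apply: (addIr (f z)); rewrite -fD !addNr.
have fx0 : f x != 0 by rewrite -f0 (inj_eq inj_f).
have fxy : f x ** f y = f y ** f x by rewrite -!fM xy.
have [E|E|E] := tightS _ _ fx0 fxy; [constructor 1|constructor 2|constructor 3].
- by apply: inj_f; rewrite f0.
- exact: inj_f.
- by apply: inj_f; rewrite fN.
Qed.

(** A vanishing determinant makes q a multiple of p, and the only scalars are 0
    and 1. *)
Lemma F2_row_parallel (p q : 'rV['F_2]_2) :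
  p != 0 -> p 0 0 * q 0 1 = q 0 0 * p 0 1 -> q = 0 \/ q = p.
Proof.
move=> p0 det0; suff [c ->] : exists c, q = c *: p.
  by have [->|->] := F2P c; rewrite ?scale0r ?scale1r; [left|right].
have [P0|P0] := F2P (p 0 0); rewrite P0 ?mul0r ?mul1r in det0.
  have P1 : p 0 1 = 1.
    by have [P1|//] := F2P (p 0 1); case/eqP: p0; apply: row2P; rewrite mxE.
  rewrite P1 mulr1 in det0.
  by exists (q 0 1); apply: row2P; rewrite mxE ?P0 ?P1 ?mulr0 ?mulr1.
by exists (q 0 0); apply: row2P; rewrite mxE ?P0 ?mulr1.
Qed.

Lemma tight_ringE : tight_centralizers ringE.
Proof.
move=> p q p0 pq.
suff [->|->] : q = 0 \/ q = p by [constructor 1|constructor 2].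
apply: F2_row_parallel => //.
have /rowP/(_ 0) : mulE p q = mulE q p by [].
by rewrite !mxE /= !(mulr1, mulr0, addr0) [q 0 0 * p 0 0]mulrC => /addrI.
Qed.

Lemma tight_ringF : tight_centralizers ringF.
Proof.
move=> p q p0 pq.
suff [->|->] : q = 0 \/ q = p by [constructor 1|constructor 2].
apply: F2_row_parallel => //.
have /rowP/(_ 0) : mulF p q = mulF q p by [].
rewrite !mxE /= !(mulr1, mulr0, addr0) [q 0 0 * p 0 0]mulrC => /addrI.
by rewrite mulrC [RHS]mulrC => ->.
Qed.

(** * The two cases *)

Lemma tight_even_isom (R : finNuRingType) :
  tight_centralizers R -> ~~ odd #|R| -> nucenter R = [set 0] ->
  ~ commutative (@numul R) -> nuring_isom R ringE \/ nuring_isom R ringF.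
Proof.
move=> tightR evenR center_R noncomm.
have char2 := tight_even_char2 tightR evenR.
have [x [y [x0 y0 xy span [xx yy tables]]]] :=
  tight_char2_structure char2 tightR center_R noncomm.
have bij := F2comb_bij char2 x0 y0 xy span.
have combD := F2combD x y char2.
case: tables => [[Exy Eyx]|[Exy Eyx]]; [left|right]; apply: nuring_isom_sym;
  exists (F2comb x y); split=> // p q; apply: F2comb_bilin2 => //;
  by rewrite ?F2comb_gx ?F2comb_gy.
Qed.

(** The matching pairs x with -x, which is distinct from x in odd order. *)
Lemma tight_odd_matching (R : finNuRingType) :
  tight_centralizers R -> odd #|R| -> nucenter R = [set 0] ->
  sgraph_isom (commuting_graph R)
              (copies (#|commuting_graph R| %/ 2)%N (path_graph 2)).
Proof.
move=> tightR /odd_card_zmod inj2 center_R.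
have v0 (v : commuting_graph R) : val v != 0.
  by rewrite -mem_noncentral //; exact: (valP v).
have oppP (v : commuting_graph R) : - val v \notin nucenter R.
  by rewrite mem_noncentral // oppr_eq0.
pose s (v : commuting_graph R) : commuting_graph R := Sub (- val v) (oppP v).
have s_free v : s v != v.
  apply/eqP=> /(congr1 val); rewrite SubK => /eqP.
  rewrite eq_sym -addr_eq0 => /eqP/inj2/eqP; exact/negP.
apply: (@involution_matching _ s) => [v|//|u v].
  by apply: val_inj; rewrite !SubK opprK.
apply/andP/eqP=> [[uv /eqP/(tightR _ _ (v0 u))]|->].
  case=> E.
  - by have := v0 v; rewrite E eqxx.
  - by case/eqP: uv; apply: val_inj.
  - by apply: val_inj; rewrite SubK.
by rewrite eq_sym s_free SubK numulNr numulrN.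
Qed.

Theorem theoremD (R : finNuRingType) (n : nat)
    (card_R : #|R| = n)
    (noncomm_R : ~ commutative (@numul R))
    (center_R : nucenter R = [set 0]) :
  (~~ odd n ->
     (gamma_s (commuting_graph R) = n%:Z - 1 <->
      nuring_isom R ringE \/ nuring_isom R ringF)) /\
  (odd n ->
     (gamma_s (commuting_graph R) = n%:Z - 1 <->
      sgraph_isom (commuting_graph R)
                  (copies ((n - 1) %/ 2)%N (path_graph 2)))).
Proof.
have gammaP := gamma_s_commuting_graph center_R.
have cardV := card_commuting_graph center_R.
subst n; split=> parity_R.
  apply: (iff_trans gammaP); split=> [tightR|[isoE|isoF]].
  - exact: tight_even_isom.
  - exact: tight_isom isoE tight_ringE.
  - exact: tight_isom isoF tight_ringF.
have -> : (#|R| - 1)%N = #|commuting_graph R| by lia.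
split=> [/gammaP tightR|/gamma_s_matching->]; last by rewrite cardV.
exact: tight_odd_matching.
Qed.
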